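(* Let $\alpha\in(0,1)\cup(1,\infty)$ and let $W_1:X\mapsto Y_1$ and $W_2:X\mapsto Y_2$ be BISO channels with the same $\alpha$-capacity $C_\alpha$ and with $\alpha$-Lorenz curves $F_{\alpha,1}$ and $F_{\alpha,2}$ (both defined on the common interval $[0,d_C]$). Suppose $F_{\alpha,1}(t)\le F_{\alpha,2}(t)$ for all $t\in[0,d_C]$. Then: if $\alpha>1$, or $\frac12\le\alpha<1$, or $0<\alpha\le\frac13$, $W_1$ is $\alpha$-more capable than $W_2$; and if $\frac13\le\alpha\le\frac12$, $W_2$ is $\alpha$-more capable than $W_1$.
   Context: A binary input symmetric output (BISO) channel has input alphabet $\{0,1\}$ and output alphabet $\{0,\pm1,\dots,\pm l\}$ with $P_{Y|X}(y|0)=P_{Y|X}(-y|1)=:p_y$. The output $0$ (if present) is split into two outputs $0_+$ and $0_-$ with $P_{Y|X}(0_+|0)=P_{Y|X}(0_-|0)=p_0/2$ (and symmetrically for input $1$), so that the outputs are grouped into symmetric pairs $\{y,-y\}$, indexed below by ''$y>0$''. For $\beta>0$ let $k_\beta(q)=q^\beta+(1-q)^\beta$ for $q\in[0,1]$. Sibson's Rényi mutual information of an input distribution $P_X$ on $\{0,1\}$ and channel $P_{Y|X}$ is $I^S_\alpha(X:Y)=\frac{\alpha}{\alpha-1}\log\sum_y\big(\sum_x P_X(x)P_{Y|X}(y|x)^\alpha\big)^{1/\alpha}$; the $\alpha$-capacity is $C_\alpha(P_{Y|X})=\sup_{P_X}I^S_\alpha(X:Y)$. A channel $W_1:X\mapsto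 Y_1$ is $\alpha$-more capable than $W_2:X\mapsto Y_2$ if $I^S_\alpha(X:Y_1)\ge I^S_\alpha(X:Y_2)$ for every input distribution $P_X$. For a BISO channel, set $d_C=\sum_{y>0}(p_y^\alpha+p_{-y}^\alpha)^{1/\alpha}$ (for BISO channels $C_\alpha=\log2-\frac{\alpha}{\alpha-1}\log d_C$, so channels with equal $\alpha$-capacity have equal $d_C$). The $\alpha$-BISO partition: order the pairs $y>0$ by a permutation $\pi$ so that $k_{1/\alpha}\big(\frac{p_{\pi_i}^\alpha}{p_{\pi_i}^\alpha+p_{-\pi_i}^\alpha}\big)$ is ascending in $i$, and set $t_0=0$, $t_k=\sum_{i=1}^k(p_{\pi_i}^\alpha+p_{-\pi_i}^\alpha)^{1/\alpha}$. The $\alpha$-BISO curve is the step function $f_\alpha$ with $f_\alpha(0)=0$ and $f_\alpha(t)=k_{1/\alpha}\big(\frac{p_{\pi_k}^\alpha}{p_{\pi_k}^\alpha+p_{-\pi_k}^\alpha}\big)$ on $(t_{k-1},t_k]$. The $\alpha$-Lorenz curve is $F_\alpha(t)=\int_0^t f_\alpha(\tau)\,d\tau$ for $t\in[0,d_C]$. *)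

(* Defs.v *)
From HB Require Import structures.
From mathcomp Require Import all_boot all_order all_algebra.
From mathcomp Require Import all_classical all_reals all_analysis.
Set Implicit Arguments. Unset Strict Implicit. Unset Printing Implicit Defensive.
Import Order.TTheory GRing.Theory Num.Theory.
Import numFieldNormedType.Exports.
Local Open Scope classical_set_scope.
Local Open Scope ring_scope.

(* A BISO channel (with the output 0, if present, already split into 0_+ and
   0_-) is described by its list of symmetric output pairs {y,-y}, y>0:
   each pair is (p_y, p_{-y}) = (P(y|0), P(-y|0)), and by symmetry
   P(y|1) = p_{-y}, P(-y|1) = p_y. *)
Definition biso_channel (R : realType) := seq (R * R).

Definition is_biso (R : realType) (W : biso_channel R) : Prop :=
  (forall pr, pr \in W -> 0 <= pr.1 /\ 0 <= pr.2) /\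
  \sum_(pr <- W) (pr.1 + pr.2) = 1.

(* Sibson's alpha-mutual information for the input distribution
   P_X = (q, 1-q) on {0,1}:
   alpha/(alpha-1) log sum_y (sum_x P_X(x) P(y|x)^alpha)^(1/alpha). *)
Definition sibsonMI (R : realType) (alpha : R) (W : biso_channel R) (q : R) : R :=
  alpha / (alpha - 1) *
  ln (\sum_(pr <- W)
        ((q * pr.1 `^ alpha + (1 - q) * pr.2 `^ alpha) `^ alpha^-1
       + (q * pr.2 `^ alpha + (1 - q) * pr.1 `^ alpha) `^ alpha^-1)).

Definition alpha_capacity (R : realType) (alpha : R) (W : biso_channel R) : R :=
  sup [set sibsonMI alpha W q | q in `[0, 1]].

Definition more_capable (R : realType) (alpha : R) (W1 W2 : biso_channel R) : Prop :=
  forall q : R, 0 <= q <= 1 -> sibsonMI alpha W2 q <= sibsonMI alpha W1 q.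

Definition kfun (R : realType) (beta q : R) : R := q `^ beta + (1 - q) `^ beta.

Definition pair_weight (R : realType) (alpha : R) (pr : R * R) : R :=
  (pr.1 `^ alpha + pr.2 `^ alpha) `^ alpha^-1.

Definition pair_key (R : realType) (alpha : R) (pr : R * R) : R :=
  kfun alpha^-1 (pr.1 `^ alpha / (pr.1 `^ alpha + pr.2 `^ alpha)).

Definition dC (R : realType) (alpha : R) (W : biso_channel R) : R :=
  \sum_(pr <- W) pair_weight alpha pr.

Definition biso_sorted (R : realType) (alpha : R) (W : biso_channel R) : seq (R * R) :=
  sort (fun u v => pair_key alpha u <= pair_key alpha v) W.

(* step function on the partition: given the remaining sorted pairs and the
   left endpoint t0 of the current cell, value at t *)
Fixpoint step_aux (R : realType) (alpha : R) (s : seq (R * R)) (t0 t : R) : R :=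
  match s with
  | [::] => 0
  | pr :: s' => if t <= t0 + pair_weight alpha pr then pair_key alpha pr
                else step_aux alpha s' (t0 + pair_weight alpha pr) t
  end.

(* alpha-BISO curve f_alpha: f(0)=0 and f = key of the k-th pair on
   (t_{k-1}, t_k]  (set to 0 outside (0, d_C]). *)
Definition biso_curve (R : realType) (alpha : R) (W : biso_channel R) (t : R) : R :=
  if t <= 0 then 0 else step_aux alpha (biso_sorted alpha W) 0 t.

Definition lorenz_curve (R : realType) (alpha : R) (W : biso_channel R) (t : R) : R :=
  \int[lebesgue_measure]_(x in `[0, t]) biso_curve alpha W x.

(* Main.v *)
Require Import Defs.
From HB Require Import structures.
From mathcomp Require Import all_boot all_order all_algebra.
From mathcomp Require Import all_classical all_reals all_analysis.
From mathcomp Require Import measurable_realfun ring lra.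
Import Order.TTheory GRing.Theory Num.Theory.
Import numFieldNormedType.Exports.
Set Implicit Arguments.
Unset Strict Implicit.
Unset Printing Implicit Defensive.
Local Open Scope classical_set_scope.
Local Open Scope ring_scope.

(** Put [b = 1 / alpha] and [h x = ((1 + x) / 2)^b + ((1 - x) / 2)^b].  A pair
    of outputs with weight [w] and tilt [x] in [[0, 1]] has key [h x] and, for
    the input distribution [(q, 1 - q)], contributes [w * h (c x)] with
    [c = |1 - 2 q|] to the sum inside Sibson's mutual information, which is then
    [- (b - 1)^-1] times the logarithm of that sum.

    The uniform input is optimal, so equal capacities give equal total weights,
    and the keys have weighted sum [1] for every channel.  Hence the
    ordering of the Lorenz curves is a majorization of the weighted keys: in
    dual form, [sum w (r - key)_+ = max_t (r t - F t)], so the hinge sums are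
    ordered, and so are the sums of every convex function of the key.

    It remains to see when [h (c x)] is convex or concave as a function of
    [h x], i.e. in which direction [h'(c x) / h'(x)] is monotone.  With
    [g = b - 1] and [L = ln ((1 + x) / (1 - x))], the elasticity
    [x h''(x) / h'(x)] is [g/2 (1 + sinh ((1 - g/2) L) / sinh (g/2 L))], whose
    direction of monotonicity is the sign of [(1 - g) (2 - g)]; this produces
    the thresholds [alpha = 1/2] and [alpha = 1/3]. *)

(** * Convexity of [h (c x)] in [h x] *)

Section calculus.
Context {R : realType}.
Implicit Types a b c e g x y : R.

Lemma ge0_is_derive_le (f df : R -> R) a b : a <= b ->
  (forall x, a < x < b -> is_derive x 1 f (df x)) ->
  {within `[a, b], continuous f} ->
  (forall x, a < x < b -> 0 <= df x) -> f a <= f b.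
Proof.
rewrite le_eqVlt => /predU1P[-> //|ab] fdf cf df0.
have fdf' x : x \in `]a, b[ -> is_derive x 1 f (df x).
  by rewrite in_itv /=; exact: fdf.
have [x xab E] := MVT ab fdf' cf.
by rewrite -subr_ge0 E mulr_ge0 ?df0 // ?subr_ge0 ?ltW // (itvP xab).
Qed.

Lemma is_derive_within (f df : R -> R) a b :
  (forall x, a <= x <= b -> is_derive x 1 f (df x)) ->
  {within `[a, b], continuous f}.
Proof.
move=> fdf; apply: derivable_within_continuous => x; rewrite in_itv /= => xab.
by have [] := fdf _ xab.
Qed.

(** * Twice the hyperbolic sine and cosine, and quotients of the sines *)

Definition sh x : R := expR x - expR (- x).
Definition ch x : R := expR x + expR (- x).

Lemma sh0 : sh 0 = 0. Proof. by rewrite /sh oppr0 subrr. Qed.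
Lemma shN x : sh (- x) = - sh x. Proof. by rewrite /sh opprK opprB. Qed.

Lemma sh_gt0 x : 0 < x -> 0 < sh x.
Proof. by move=> x0; rewrite /sh subr_gt0 ltr_expR; lra. Qed.

Lemma sh_ge0 x : 0 <= x -> 0 <= sh x.
Proof. by rewrite le_eqVlt => /predU1P[<-|/sh_gt0/ltW//]; rewrite sh0. Qed.

(** [sh] is odd, so both factors carry the sign of [a]; this spares case distinctions on signs
    later. *)
Lemma mul_sh_ge0 a x : 0 <= x -> 0 <= a * sh (a * x).
Proof.
move=> x0; have [a0|a0] := leP 0 a; first by rewrite mulr_ge0 ?sh_ge0 ?mulr_ge0.
by rewrite -mulrNN -shN mulr_ge0 ?sh_ge0 // -?mulNr ?mulr_ge0; lra.
Qed.

Lemma mul_sh_gt0 a x : a != 0 -> 0 < x -> 0 < a * sh (a * x).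
Proof.
move=> a0 x0; have [{}a0|{}a0|a00] := ltgtP a 0; last by rewrite a00 eqxx in a0.
  by rewrite -mulrNN -shN mulr_gt0 ?sh_gt0 // -?mulNr ?mulr_gt0; lra.
by rewrite mulr_gt0 ?sh_gt0 ?mulr_gt0.
Qed.

Lemma is_derive_expRM a x :
  is_derive x 1 (fun t => expR (a * t)) (a * expR (a * x)).
Proof.
have d : is_derive x 1 (fun t => a * t) a.
  by apply: is_derive_eq; rewrite /GRing.scale /=; ring.
by have := is_derive1_comp (is_derive_expR (a * x)) d; rewrite mulrC.
Qed.

Lemma is_derive_sh a x : is_derive x 1 (fun t => sh (a * t)) (a * ch (a * x)).
Proof.
rewrite /sh; under eq_fun do rewrite -mulNr.
apply: (is_derive_eq (is_deriveB (is_derive_expRM a x) (is_derive_expRM (- a) x))).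
by rewrite /ch -(mulNr a x); ring.
Qed.

Lemma is_derive_ch a x : is_derive x 1 (fun t => ch (a * t)) (a * sh (a * x)).
Proof.
rewrite /ch; under eq_fun do rewrite -mulNr.
apply: (is_derive_eq (is_deriveD (is_derive_expRM a x) (is_derive_expRM (- a) x))).
by rewrite /sh -(mulNr a x); ring.
Qed.

(** Up to [e], this is the numerator of the derivative of [sh (a * t) / sh (b * t)]. It vanishes at
    [0], and in its own derivative the products of [ch] cancel. *)
Lemma sh_ch_cross_ge0 a b e x : 0 <= e * ((a ^+ 2 - b ^+ 2) * a * b) -> 0 <= x ->
  0 <= e * (a * ch (a * x) * sh (b * x) - b * sh (a * x) * ch (b * x)).
Proof.
move=> eab x0.
pose D t := e * (a * ch (a * t) * sh (b * t) - b * sh (a * t) * ch (b * t)).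
pose dD t := e * ((a ^+ 2 - b ^+ 2) * sh (a * t) * sh (b * t)).
have dDP (t : R) : is_derive t 1 D (dD t).
  have da := is_derive_sh a t; have db := is_derive_sh b t.
  have ca := is_derive_ch a t; have cb := is_derive_ch b t.
  rewrite /D; apply: is_derive_eq; rewrite /dD /GRing.scale /=; ring.
have -> : 0 = D 0 by rewrite /D !mulr0 sh0; ring.
apply: (@ge0_is_derive_le D dD) => //; first exact: is_derive_within.
move=> t /andP[/ltW t0 _].
rewrite /dD; have [->|a0] := eqVneq a 0; first by rewrite mul0r sh0 mulr0 mul0r mulr0.
have [->|b0] := eqVneq b 0; first by rewrite mul0r sh0 !mulr0.
(* This positive factor pairs each [sh] with its own coefficient and leaves the hypothesis on
   [e]. *)
have ab : 0 < (a * b) ^+ 2 by rewrite exprn_even_gt0 //= mulf_neq0.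
rewrite -(pmulr_rge0 _ ab).
have -> : (a * b) ^+ 2 * (e * ((a ^+ 2 - b ^+ 2) * sh (a * t) * sh (b * t))) =
   e * ((a ^+ 2 - b ^+ 2) * a * b) * (a * sh (a * t)) * (b * sh (b * t)).
  by ring.
by apply: mulr_ge0; [apply: mulr_ge0 => //|]; exact: mul_sh_ge0.
Qed.

Lemma is_derive_div (f h : R -> R) x df dh : h x != 0 ->
  is_derive x 1 f df -> is_derive x 1 h dh ->
  is_derive x 1 (fun t => f t / h t) ((df * h x - f x * dh) / (h x) ^+ 2).
Proof.
move=> hx fP hP.
have iP : is_derive x 1 (fun t => (h t)^-1) (- (h x) ^- 2 *: dh).
  by apply: is_deriveV.
apply: (is_derive_eq (is_deriveM fP iP)); rewrite /GRing.scale /=; field.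
exact: hx.
Qed.

(* [sh (a t) / sh (b t)] is monotone in [t > 0]; the factor [e] carries the
   direction. *)
Lemma sh_cross_ge0 a b e x y : 0 <= e * ((a ^+ 2 - b ^+ 2) * a * b) ->
  0 <= x <= y -> 0 <= e * (sh (a * y) * sh (b * x) - sh (a * x) * sh (b * y)).
Proof.
move=> eab /andP[]; rewrite le_eqVlt => /predU1P[<- _|x0 xy].
  by rewrite !mulr0 sh0 mul0r mulr0 subr0 mulr0.
have [->|b0] := eqVneq b 0; first by rewrite !mul0r sh0 !mulr0 subr0 mulr0.
have sb t : 0 < t -> sh (b * t) != 0.
  by move=> t0; have := mul_sh_gt0 b0 t0; apply: contraTneq => ->; rewrite mulr0 ltxx.
pose Q t := e * sh (a * t) / sh (b * t).
pose dQ t := ((e * (a * ch (a * t))) * sh (b * t) - e * sh (a * t) * (b * ch (b * t)))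
  / sh (b * t) ^+ 2.
have dQP (t : R) : 0 < t -> is_derive t 1 Q (dQ t).
  move=> t0; apply: (@is_derive_div (fun t => e * sh (a * t)) (fun t => sh (b * t)));
    [exact: sb| |exact: is_derive_sh].
  have d := is_derive_sh a t.
  by apply: is_derive_eq; rewrite /GRing.scale /=; ring.
have QQ : Q x <= Q y.
  apply: (@ge0_is_derive_le Q dQ); [exact: xy| | |].
  - by move=> t /andP[xt _]; apply: dQP; lra.
  - by apply: (@is_derive_within Q dQ) => t /andP[xt _]; apply: dQP; lra.
  - move=> t /andP[xt _]; rewrite /dQ divr_ge0 ?sqr_ge0 //.
    have -> : e * (a * ch (a * t)) * sh (b * t) - e * sh (a * t) * (b * ch (b * t))
      = e * (a * ch (a * t) * sh (b * t) - b * sh (a * t) * ch (b * t)) by ring.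
    by apply: sh_ch_cross_ge0 => //; lra.
have y0 : 0 < y by lra.
have b2 : 0 < b ^+ 2 by rewrite exprn_even_gt0.
rewrite -(pmulr_rge0 _ b2).
have -> : b ^+ 2 * (e * (sh (a * y) * sh (b * x) - sh (a * x) * sh (b * y))) =
  (b * sh (b * x)) * (b * sh (b * y)) * (Q y - Q x).
  by rewrite /Q; field; rewrite !sb.
by apply: mulr_ge0; rewrite ?subr_ge0 // mulr_ge0 // ltW // mul_sh_gt0.
Qed.

(** With [g = b - 1], the derivative of [h] up to the factor [b / 2]. *)
Definition pdiff g x : R := ((1 + x) / 2) `^ g - ((1 - x) / 2) `^ g.
Definition dpdiff g x : R :=
  g / 2 * (((1 + x) / 2) `^ (g - 1) + ((1 - x) / 2) `^ (g - 1)).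

Lemma is_derive_affine a b x : is_derive x 1 (fun t => (a + b * t) / 2) (b / 2).
Proof.
apply: is_derive_eq; rewrite /GRing.scale /=; ring.
Qed.

Lemma is_derive_powR_affine g a b x : 0 < a + b * x ->
  is_derive x 1 (fun t => ((a + b * t) / 2) `^ g)
    (b / 2 * (g * ((a + b * x) / 2) `^ (g - 1))).
Proof.
move=> p0; have p : 0 < (a + b * x) / 2 by lra.
have := @is_derive1_comp _ _ (fun t => (a + b * t) / 2) _ _ _
  (is_derive1_powR g p) (is_derive_affine a b x).
by rewrite mulrC.
Qed.

Lemma is_derive_pdiff g c x : -1 < c * x < 1 ->
  is_derive x 1 (fun t => pdiff g (c * t)) (c * dpdiff g (c * x)).
Proof.
move=> /andP[cx1 cx2].
have p1 : 0 < 1 + c * x by lra.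
have p2 : 0 < 1 + (- c) * x by lra.
have d1 := is_derive_powR_affine g p1.
have d2 := is_derive_powR_affine g p2.
rewrite /pdiff; under eq_fun do rewrite -mulNr.
apply: (is_derive_eq (is_deriveB d1 d2)).
by rewrite /dpdiff -(mulNr c x); field.
Qed.

(* With [p = (1 + x) / 2], [m = (1 - x) / 2] and [L = ln (p / m)], the
   elasticity [x A'(x) / A(x)] of [A = p^g - m^g] equals
   [g / 2 * (1 + sinh ((1 - g/2) L) / sinh (g/2 L))]. *)
Lemma pdiff_sh g x : -1 < x < 1 -> let L := ln ((1 + x) / 2) - ln ((1 - x) / 2) in
  exists2 M : R, 0 < M & pdiff g x = M * sh (g / 2 * L) /\
   x * dpdiff g x = g / 2 * M * (sh (g / 2 * L) + sh ((1 - g / 2) * L)).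
Proof.
move=> /andP[x1 x2] L.
have p0 : 0 < (1 + x) / 2 by lra.
have m0 : 0 < (1 - x) / 2 by lra.
have powE t k : 0 < t -> t `^ k = expR (k * ln t) by move=> t0; rewrite /powR gt_eqF.
rewrite /pdiff /dpdiff !powE // {}/L; set u := ln _; set v := ln _.
have xE : x = expR u - expR v by rewrite !lnK ?posrE //; field.
exists (expR (g / 2 * (u + v))); first exact: expR_gt0.
split; rewrite /sh.
  by rewrite mulrBr -!expRD; congr (expR _ - expR _); field.
rewrite [X in X * _]xE.
transitivity (g / 2 * (expR (g * u) - expR (g * v) + (expR (u + (g - 1) * v)
    - expR (v + (g - 1) * u)))).
  have -> : g * u = u + (g - 1) * u by ring.
  have -> : g * v = v + (g - 1) * v by ring.
  by rewrite !expRD; ring.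
rewrite -[RHS]mulrA; congr (_ * _); rewrite mulrDr !mulrBr -!expRD.
by congr (expR _ - expR _ + (expR _ - expR _)); field.
Qed.

Lemma logodds_ge0 x y : 0 <= x <= y -> y < 1 ->
  0 <= ln ((1 + x) / 2) - ln ((1 - x) / 2) <= ln ((1 + y) / 2) - ln ((1 - y) / 2).
Proof.
move=> /andP[x0 xy] y1; have lnle (u v : R) : 0 < u -> u <= v -> ln u <= ln v.
  by move=> u0 uv; rewrite ler_ln ?posrE //; lra.
have h1 : ln ((1 - x) / 2) <= ln ((1 + x) / 2) by apply: lnle; lra.
have h2 : ln ((1 + x) / 2) <= ln ((1 + y) / 2) by apply: lnle; lra.
have h3 : ln ((1 - y) / 2) <= ln ((1 - x) / 2) by apply: lnle; lra.
lra.
Qed.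

Lemma logodds_gt0 x : 0 < x < 1 -> 0 < ln ((1 + x) / 2) - ln ((1 - x) / 2).
Proof. by move=> /andP[x0 x1]; rewrite subr_gt0 ltr_ln ?posrE; lra. Qed.

Lemma mul_pdiff_gt0 g x : g != 0 -> 0 < x < 1 -> 0 < g * pdiff g x.
Proof.
move=> g0 /andP[x0 x1]; have [|M M0 [-> _]] := @pdiff_sh g x; first lra.
have -> (S : R) : g * (M * S) = (2 * M) * (g / 2 * S) by field.
apply: mulr_gt0; first by rewrite mulr_gt0.
apply: mul_sh_gt0; first by rewrite mulf_neq0 // invr_eq0 pnatr_eq0.
by apply: logodds_gt0; rewrite x0.
Qed.

(** A comparison of the elasticities of [pdiff g] at [x] and [c * x]. After [pdiff_sh] the common
    terms cancel, and [sh_cross_ge0] applies at the two log-odds. *)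
Lemma pdiff_cross_ge0 g e c x : 0 <= e * ((1 - g) * (2 - g)) ->
  0 <= c <= 1 -> 0 < x < 1 ->
  0 <= e * (pdiff g (c * x) * dpdiff g x - c * dpdiff g (c * x) * pdiff g x).
Proof.
move=> eg /andP[c0 c1] /andP[x0 x1].
have cx : 0 <= c * x <= x by apply/andP; split; [apply: mulr_ge0|apply: ler_piMl]; lra.
have [|M M0 [A1 A2]] := @pdiff_sh g x; first lra.
have [|N N0 [B1 B2]] := @pdiff_sh g (c * x); first lra.
rewrite -(pmulr_rge0 _ x0).
set L := _ - _ in A1 A2; set K := _ - _ in B1 B2.
have -> : x * (e * (pdiff g (c * x) * dpdiff g x - c * dpdiff g (c * x) * pdiff g x))
  = e * (pdiff g (c * x) * (x * dpdiff g x) - (c * x * dpdiff g (c * x)) * pdiff g x).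
  by ring.
rewrite A1 A2 B1 B2.
set s1 := sh _; set s2 := sh _; set s3 := sh _; set s4 := sh _.
have -> : e * (N * s1 * (g / 2 * M * (s2 + s3)) - g / 2 * N * (s1 + s4) * (M * s2))
  = N * M * (e * g / 2 * (s3 * s1 - s4 * s2)) by ring.
apply: mulr_ge0; first by rewrite mulr_ge0 // ltW.
apply: sh_cross_ge0.
  (* Here [(1 - g / 2) ^+ 2 - (g / 2) ^+ 2 = 1 - g], which brings in the sign of
     [(1 - g) * (2 - g)]. *)
  have -> : e * g / 2 * (((1 - g / 2) ^+ 2 - (g / 2) ^+ 2) * (1 - g / 2) * (g / 2))
    = e * ((1 - g) * (2 - g)) * (g ^+ 2 / 8) by field.
  by apply: mulr_ge0 => //; rewrite divr_ge0 ?sqr_ge0.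
exact: logodds_ge0.
Qed.

(** The derivative of [h (c x)] with respect to [h x], for [g = b - 1]. *)
Definition slope g c x : R := c * pdiff g (c * x) / pdiff g x.

Lemma slope_monotone g e c x y : g != 0 -> 0 <= e * ((1 - g) * (2 - g)) ->
  0 <= c <= 1 -> 0 < x -> x <= y -> y < 1 -> 0 <= e * (slope g c x - slope g c y).
Proof.
move=> g0 eg c01 x0 xy y1.
have nz t : 0 < t < 1 -> pdiff g t != 0.
  by move=> /(mul_pdiff_gt0 g0); apply: contraTneq => ->; rewrite mulr0 ltxx.
(* The minus sign makes the expected direction an increase, as [ge0_is_derive_le] requires. *)
pose Q t := - e * c * pdiff g (c * t) / pdiff g t.
pose dQ t := (- e * c * (c * dpdiff g (c * t)) * pdiff g t
   - - e * c * pdiff g (c * t) * dpdiff g t) / (pdiff g t) ^+ 2.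
have dQP (t : R) : x <= t <= y -> is_derive t 1 Q (dQ t).
  move=> xty; have t01 : 0 < t < 1 by lra.
  rewrite /Q /dQ.
  apply: (@is_derive_div (fun t => - e * c * pdiff g (c * t)) (pdiff g)); first exact: nz.
    have ct : -1 < c * t < 1.
      have /andP[? ?] := c01; have : 0 <= c * t <= t; last lra.
      by apply/andP; split; [apply: mulr_ge0|apply: ler_piMl]; lra.
    have d := is_derive_pdiff g ct.
    by apply: is_derive_eq; rewrite /GRing.scale /=; ring.
  have t1 : -1 < 1 * t < 1 by lra.
  have := is_derive_pdiff g t1; rewrite !mul1r.
  by under eq_fun do rewrite mul1r.
have QQ : Q x <= Q y.
  apply: (@ge0_is_derive_le Q dQ); [exact: xy| | |].
  - by move=> t xty; apply: dQP; lra.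
  - exact: is_derive_within dQP.
  - move=> t xty; rewrite /dQ divr_ge0 ?sqr_ge0 //.
    have -> : - e * c * (c * dpdiff g (c * t)) * pdiff g t
     - - e * c * pdiff g (c * t) * dpdiff g t =
     c * (e * (pdiff g (c * t) * dpdiff g t - c * dpdiff g (c * t) * pdiff g t)) by ring.
    have /andP[? ?] := c01.
    by rewrite mulr_ge0 // pdiff_cross_ge0 //; lra.
by move: QQ; rewrite /Q /slope -!mulrA !mulNr; lra.
Qed.

(* [powR] takes the value 1 at negative arguments; clipping at 0 makes the
   power continuous on the whole line. *)
Definition pospow b x : R := Num.max x 0 `^ b.

Lemma pospowE b x : 0 <= x -> pospow b x = x `^ b.
Proof. by move=> x0; rewrite /pospow max_l. Qed.

Lemma near_pospowE b x : 0 < x -> \near x, x `^ b = pospow b x.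
Proof.
move=> x0; near=> t; rewrite pospowE //; apply: ltW; near: t.
exact: lt_nbhsr.
Unshelve. all: by end_near. Qed.

(** Continuity at [0] matters at the tilt [1], where the base [(1 - x) / 2] vanishes. *)
Lemma continuous_pospow b : 0 < b -> continuous (pospow b).
Proof.
move=> b0; suff H (x : R) : pospow b t @[t --> x] --> pospow b x by [].
have [x0|x0|->] := ltgtP x 0.
- apply/cvgrPdist_lt => /= d d0; near=> t.
  have t0 : t < 0 by near: t; exact: lt_nbhsl.
  by rewrite /pospow !max_r ?(ltW x0) ?(ltW t0) // subrr normr0.
- apply: differentiable_continuous; apply/derivable1_diffP.
  by have [] := near_eq_is_derive (near_pospowE b x0) (is_derive1_powR b x0).
- rewrite /continuous_at {2}/pospow maxxx powR0 ?gt_eqF //.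
  apply/cvgrPdist_lt => /= d d0; near=> t.
  rewrite sub0r normrN ger0_norm ?powR_ge0 //.
  (* A radius of [d] to the power [1 / b] keeps the values below [d]. *)
  have -> : d = (d `^ b^-1) `^ b by rewrite -powRrM mulVf ?gt_eqF // powRr1 // ltW.
  rewrite gt0_ltr_powR // ?nnegrE ?powR_ge0 ?le_max ?lexx ?orbT //.
  have h : 0 < d `^ b^-1 by exact: powR_gt0.
  by rewrite gt_max h andbT; near: t; exact: lt_nbhsl (powR_gt0 _ d0).
Unshelve. all: by end_near. Qed.

Definition hfun b x : R := pospow b ((1 + x) / 2) + pospow b ((1 - x) / 2).

Lemma hfunE b x : -1 <= x <= 1 -> hfun b x = kfun b ((1 + x) / 2).
Proof.
move=> x1; rewrite /hfun /kfun !pospowE; [|lra|lra].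
by congr (_ + _ `^ _); field.
Qed.

Lemma hfunN b x : hfun b (- x) = hfun b x.
Proof. by rewrite /hfun opprK addrC. Qed.

Lemma hfun_norm b x : hfun b `|x| = hfun b x.
Proof. by case: ger0P => _ //; rewrite hfunN. Qed.

Lemma hfun_gt0 b x : 0 < hfun b x.
Proof.
wlog x0 : x / 0 <= x => [th|].
  by have [/th//|/ltW] := leP 0 x; rewrite -oppr_ge0 => /th; rewrite hfunN.
rewrite /hfun ltr_pwDl ?powR_ge0 // powR_gt0 // lt_max; apply/orP; left; lra.
Qed.

Lemma continuous_hfunM b c : 0 < b -> continuous (fun t => hfun b (c * t)).
Proof.
move=> b0 x; rewrite /hfun; apply: cvgD.
  apply: (@continuous_comp _ _ _ (fun t => (1 + c * t) / 2) (pospow b)).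
    by have [/derivable1_diffP/differentiable_continuous] := is_derive_affine 1 c x.
  exact: continuous_pospow.
apply: (@continuous_comp _ _ _ (fun t => (1 - c * t) / 2) (pospow b)).
  have -> : (fun t => (1 - c * t) / 2) = (fun t => (1 + (- c) * t) / 2).
    by apply/funext => t; rewrite mulNr.
  by have [/derivable1_diffP/differentiable_continuous] := is_derive_affine 1 (- c) x.
exact: continuous_pospow.
Qed.

Lemma is_derive_pospow_affine g a b x : 0 < a + b * x ->
  is_derive x 1 (fun t => pospow g ((a + b * t) / 2))
    (b / 2 * (g * ((a + b * x) / 2) `^ (g - 1))).
Proof.
move=> p0; have p : 0 < (a + b * x) / 2 by lra.
have dp := near_eq_is_derive (near_pospowE g p) (is_derive1_powR g p).
have := @is_derive1_comp _ _ (fun t => (a + b * t) / 2) _ _ _ dp (is_derive_affine a b x).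
by rewrite mulrC.
Qed.

Lemma is_derive_hfun b c x : -1 < c * x < 1 ->
  is_derive x 1 (fun t => hfun b (c * t)) (b / 2 * (c * pdiff (b - 1) (c * x))).
Proof.
move=> /andP[cx1 cx2].
have p1 : 0 < 1 + c * x by lra.
have p2 : 0 < 1 + (- c) * x by lra.
have d1 := is_derive_pospow_affine b p1.
have d2 := is_derive_pospow_affine b p2.
rewrite /hfun; under eq_fun do rewrite -mulNr.
apply: (is_derive_eq (is_deriveD d1 d2)).
by rewrite /pdiff -(mulNr c x); field.
Qed.

(** On [(0, 1)] the derivative of [h] has the sign of [b - 1]; this factor treats increase and
    decrease at once. *)
Lemma hfun_lt b x y : 0 < b -> b != 1 -> 0 <= x -> x < y -> y <= 1 ->
  (b - 1) * hfun b x < (b - 1) * hfun b y.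
Proof.
move=> b0 b1 x0 xy y1.
have g0 : b - 1 != 0 by rewrite subr_eq0.
pose df t := (b - 1) * (b / 2 * (1 * pdiff (b - 1) (1 * t))).
have dP t : t \in `]x, y[ -> is_derive t 1 (fun t => (b - 1) * hfun b t) (df t).
  rewrite in_itv /= => t01; have t1 : -1 < 1 * t < 1 by lra.
  have := is_derive_hfun b t1; under eq_fun do rewrite mul1r; move=> d.
  by apply: is_derive_eq; rewrite /GRing.scale /= /df; ring.
have cP : {within `[x, y], continuous (fun t => (b - 1) * hfun b t)}.
  apply: continuous_subspaceT => t; apply: cvgM; first exact: cvg_cst.
  by have := @continuous_hfunM b 1 b0 t; under eq_fun do rewrite mul1r.
have [t] := MVT xy dP cP; rewrite in_itv /= => txy E.
rewrite -subr_gt0 E /df !mul1r mulr_gt0 ?subr_gt0 // mulrCA mulr_gt0 //; first lra.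
by rewrite mul_pdiff_gt0 //; lra.
Qed.

Lemma hfun_le b x y : 0 < b -> b != 1 -> 0 <= x -> x <= y -> y <= 1 ->
  (b - 1) * hfun b x <= (b - 1) * hfun b y.
Proof.
move=> b0 b1 x0; rewrite le_eqVlt => /predU1P[-> //|xy y1].
by rewrite ltW // hfun_lt.
Qed.

(* Supporting-line form of: [- e (b - 1) h(c x)] is a convex function of [h x]. *)
Lemma hfun_support b e c x y : 0 < b -> b != 1 ->
  0 <= e * ((2 - b) * (3 - b)) -> 0 <= c <= 1 -> 0 < y < 1 -> 0 <= x <= 1 ->
  e * (b - 1) * (hfun b (c * x) - hfun b (c * y)) <=
  e * (b - 1) * slope (b - 1) c y * (hfun b x - hfun b y).
Proof.
move=> b0 b1 eb c01 y01 x01.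
have g0 : b - 1 != 0 by rewrite subr_eq0.
set g := b - 1; set s := slope g c y.
have nz t : 0 < t < 1 -> pdiff g t != 0.
  by move=> /(mul_pdiff_gt0 g0); apply: contraTneq => ->; rewrite mulr0 ltxx.
have cle t : 0 < t < 1 -> -1 < c * t < 1.
  move=> t01; have /andP[? ?] := c01; have : 0 <= c * t <= t; last lra.
  by apply/andP; split; [apply: mulr_ge0|apply: ler_piMl]; lra.
(* The claim is that [F 1] is minimal at [y]: its derivative is a nonnegative factor times
   [e * (s - slope g c t)]. To the left of [y], the choice [k = -1] turns the decrease into an
   increase. *)
pose F k t := k * (e * g * (s * hfun b t - hfun b (c * t))).
pose dF k t := k * (b / 2 * (g * pdiff g t) * (e * (s - slope g c t))).
have dFP (k t : R) : 0 < t < 1 -> is_derive t 1 (F k) (dF k t).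
  move=> t01; have t1 : -1 < 1 * t < 1 by lra.
  have := is_derive_hfun b t1; under eq_fun do rewrite mul1r; move=> d.
  have d' := is_derive_hfun b (cle t t01).
  rewrite /F; apply: is_derive_eq; rewrite /GRing.scale /= /dF /slope.
  by rewrite -/g !mul1r; field; exact: nz.
have cF k u v : {within `[u, v], continuous (F k)}.
  apply: continuous_subspaceT => t; rewrite /F.
  apply: cvgM; first exact: cvg_cst.
  apply: cvgM; first exact: cvg_cst.
  apply: cvgB; last exact: continuous_hfunM.
  apply: cvgM; first exact: cvg_cst.
  by have := @continuous_hfunM b 1 b0 t; under eq_fun do rewrite mul1r.
suff : F 1 y <= F 1 x by rewrite /F; lra.
have eg : 0 <= e * ((1 - g) * (2 - g)).
  by have -> : (1 - g) * (2 - g) = (2 - b) * (3 - b) by rewrite /g; ring.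
have gb t : 0 < t < 1 -> 0 <= b / 2 * (g * pdiff g t).
  by move=> t01; rewrite mulr_ge0 //; [lra|rewrite ltW // mul_pdiff_gt0].
have [xy|/ltW xy] := leP y x.
  apply: (@ge0_is_derive_le (F 1) (dF 1) y x); [exact: xy| |exact: cF|].
    by move=> t t01; apply: dFP; lra.
  move=> t t01; rewrite /dF mul1r mulr_ge0 ?gb //; first lra.
  by apply: slope_monotone => //; lra.
suff : F (-1) x <= F (-1) y by rewrite /F; lra.
apply: (@ge0_is_derive_le (F (-1)) (dF (-1)) x y); [exact: xy| |exact: cF|].
  by move=> t t01; apply: dFP; lra.
move=> t t01; rewrite /dF mulN1r -mulrN mulr_ge0 ?gb //; first lra.
rewrite -mulrN opprB.
by apply: slope_monotone => //; lra.
Qed.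

End calculus.

(** * Majorization of weighted families *)

Section majorization.
Context {R : realType} {I : Type}.
Variables (w k : I -> R).
Implicit Types (s : seq I) (u g : R -> R).

Definition hinge (c x : R) : R := Num.max (c - x) 0.

Lemma hinge_ge0 c x : 0 <= hinge c x.
Proof. by rewrite /hinge le_max lexx orbT. Qed.

Definition wsum s u : R := \sum_(i <- s) w i * u (k i).

Lemma wsumD s u v : wsum s (fun x => u x + v x) = wsum s u + wsum s v.
Proof. by rewrite /wsum -big_split; apply: eq_bigr => i _; rewrite mulrDr. Qed.

Lemma wsumZ s c u : wsum s (fun x => c * u x) = c * wsum s u.
Proof. by rewrite /wsum big_distrr; apply: eq_bigr => i _; rewrite mulrCA. Qed.

Lemma wsum_affine s a b : wsum s (fun x => a + b * x) =
  a * wsum s (fun=> 1) + b * wsum s id.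
Proof.
rewrite wsumD wsumZ; congr (_ + _); rewrite -wsumZ.
by apply: eq_bigr => i _; rewrite mulr1.
Qed.

(** A supporting line is required only at points strictly between two others. This fits
    [hfun_support], which covers only tilts [y] strictly inside [(0, 1)]. *)
Definition convex_on (z : seq R) g := forall x y t, x \in z -> y \in z -> t \in z ->
  x < y -> y < t -> exists s : R, g y + s * (x - y) <= g x /\ g y + s * (t - y) <= g t.

Variables s1 s2 : seq I.
(** Equal mass, equal mean and ordered hinge sums: the second family lies below the first in the
    convex order. *)
Hypothesis mass_eq : wsum s1 (fun=> 1) = wsum s2 (fun=> 1).
Hypothesis mean_eq : wsum s1 id = wsum s2 id.
Hypothesis hinge_le : forall c, wsum s2 (hinge c) <= wsum s1 (hinge c).

(* Interpolate [g] from right to left; each new point on the left costs a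
   nonnegative multiple of a hinge, and the interpolant stays affine to the left
   of the second point. *)
Lemma convex_interpolation (z : seq R) g : sorted <%R z -> convex_on z g ->
  exists G : R -> R, [/\ wsum s2 G <= wsum s1 G,
    {in z, G =1 g} &
    exists a b : R, forall x, (if z is _ :: z2 :: _ then x <= z2 else true) ->
      G x = a + b * x].
Proof.
have affine_le a b : wsum s2 (fun x => a + b * x) <= wsum s1 (fun x => a + b * x).
  by rewrite !wsum_affine mass_eq mean_eq.
elim: z => [|z0 [|z1 [|z2 z]] IH] /=.
- by move=> _ _; exists (fun x => 0 + 0 * x); split=> //; exists 0, 0.
- move=> _ _; exists (fun x => g z0 + 0 * x); split=> //.
    by move=> x; rewrite inE => /eqP ->; rewrite mul0r addr0.
  by exists (g z0), 0.
- rewrite andbT => z01 _.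
  pose b := (g z1 - g z0) / (z1 - z0).
  exists (fun x => g z0 - b * z0 + b * x); split=> //; last by exists (g z0 - b * z0), b.
  have z10 : z1 - z0 != 0 by rewrite subr_eq0 gt_eqF.
  by move=> x; rewrite !inE => /orP[]/eqP->; rewrite /b; field.
move=> /andP[z01 zs] cg.
have [||G [TG Gg [a [b Gab]]]] := IH; first exact: zs.
  by move=> x y t xz yz tz; apply: cg; rewrite in_cons ?xz ?yz ?tz orbT.
have z12 : z1 < z2 by case/andP: zs.
have z1min x : x \in [:: z1, z2 & z] -> z1 <= x.
  rewrite inE => /predU1P[-> //|xz].
  have p : path <%R z1 (z2 :: z) by [].
  by apply: ltW; have /allP := order_path_min lt_trans p; apply.
have z10 : z1 - z0 != 0 by rewrite subr_eq0 gt_eqF.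
(* Chosen so that adding [c * hinge z1] corrects the value at [z0]; this hinge vanishes at all the
   other points. *)
pose c := (g z0 - (a + b * z0)) / (z1 - z0).
have E1 : g z1 = a + b * z1 by rewrite -Gg ?inE ?eqxx // Gab // ltW.
have E2 : g z2 = a + b * z2 by rewrite -Gg ?inE ?eqxx ?orbT // Gab.
(* The supporting slope at [z1] is at most [b], by comparison at [z2]; hence the line through [z1]
   and [z2] passes below [g z0]. *)
have c0 : 0 <= c.
  rewrite /c divr_ge0 //; last by rewrite subr_ge0 ltW.
  have [|||||s []] := cg z0 z1 z2; rewrite ?inE ?eqxx ?orbT //.
  rewrite E1 E2 => h0 h2.
  have sb : s <= b by rewrite -(ler_pM2r (_ : 0 < z2 - z1)) ?subr_gt0 //; lra.
  have : b * (z0 - z1) <= s * (z0 - z1) by rewrite ler_wnM2r // subr_le0 ltW.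
  by lra.
exists (fun x => G x + c * hinge z1 x); split.
- by rewrite !wsumD !wsumZ lerD // ler_wpM2l.
- move=> x; rewrite in_cons => /predU1P[->|xz].
    rewrite /hinge max_l ?subr_ge0 ?ltW // Gab; last by rewrite ltW // (lt_trans z01).
    by rewrite /c; field.
  by rewrite /hinge max_r ?subr_le0 ?z1min // mulr0 addr0 Gg.
- exists (a + c * z1), (b - c) => x xz1.
  rewrite /hinge max_l ?subr_ge0 // Gab; first by ring.
  by rewrite (le_trans xz1) // ltW.
Qed.

(** Only the values of [g] at the keys enter, so [g] may be replaced by its interpolant. *)
Lemma wsum_convex_le g : convex_on (map k (s1 ++ s2)) g -> wsum s2 g <= wsum s1 g.
Proof.
move=> cg; pose z := sort <=%R (undup (map k (s1 ++ s2))).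
have zE : z =i map k (s1 ++ s2) by move=> x; rewrite mem_sort mem_undup.
have [||G [TG Gg _]] := @convex_interpolation z g.
- by rewrite sort_lt_sorted undup_uniq.
- by move=> x y t; rewrite !zE; exact: cg.
have eqG s : {subset map k s <= z} -> wsum s G = wsum s g.
  rewrite /wsum; elim: s => [|i s IH] ss; rewrite ?big_nil // !big_cons.
  rewrite Gg ?ss ?inE ?eqxx // IH // => x xs; apply: ss.
  by rewrite inE xs orbT.
by rewrite -!eqG // => x; rewrite zE map_cat mem_cat => ->; rewrite ?orbT.
Qed.

End majorization.

(** * Lorenz curves *)

Section lorenz.
Context {R : realType}.
Variable alpha : R.
Local Notation w := (pair_weight alpha).
Local Notation k := (pair_key alpha).
Local Notation mu := (@lebesgue_measure R).
Implicit Types s W : seq (R * R).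

Lemma pair_weight_ge0 pr : 0 <= w pr. Proof. exact: powR_ge0. Qed.

(** Closed form of the integral of [step_aux], with [t] measured from the left end of the first
    cell. *)
Fixpoint lorenz_poly s (t : R) : R :=
  match s with
  | [::] => 0
  | pr :: s' => if t <= w pr then k pr * t else k pr * w pr + lorenz_poly s' (t - w pr)
  end.

Lemma measurable_step_aux s t0 : measurable_fun setT (step_aux alpha s t0).
Proof.
elim: s t0 => [|pr s IH] t0 /=; first exact: measurable_cst.
apply: measurable_fun_ifT => //.
by apply: measurable_fun_ler => //; exact: measurable_cst.
Qed.

Lemma step_aux_bounded s t0 t : `|step_aux alpha s t0 t| <= \sum_(pr <- s) `|k pr|.
Proof.
elim: s t0 => [|pr s IH] t0 /=; first by rewrite big_nil normr0.
rewrite big_cons; case: ifP => _; first by rewrite lerDl sumr_ge0.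
by rewrite (le_trans (IH _)) // lerDr.
Qed.

Lemma integrable_step_aux s t0 (a b : itv_bound R) x y :
  [set` Interval a b] `<=` `[x, y] ->
  mu.-integrable [set` Interval a b] (EFin \o step_aux alpha s t0).
Proof.
move=> sub.
suff int : mu.-integrable `[x, y] (EFin \o step_aux alpha s t0).
  by apply: integrableS int.
apply: measurable_bounded_integrable => //.
- by rewrite /= lebesgue_measure_itv /=; case: ifP => _; rewrite ?ltry // -EFinB ltry.
- by apply: measurable_funTS; exact: measurable_step_aux.
- exists (\sum_(pr <- s) `|k pr|); split; first exact: num_real.
  move=> M /ltW HM z _ /=; exact: le_trans (step_aux_bounded _ _ _) HM.
Qed.

(** The integral is split at the end of the first cell. Intervals open on the left match the cells,
    so the rest sees only the tail of the list. *)
Lemma Rintegral_step_aux s t0 t : 0 <= t <= \sum_(pr <- s) w pr ->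
  \int[mu]_(x in `]t0, t0 + t]) step_aux alpha s t0 x = lorenz_poly s t.
Proof.
elim: s t0 t => [|pr s IH] t0 t /= /andP[t_ge0].
  rewrite big_nil => t_le0; rewrite set_itv_ge ?Rintegral_set0 // bnd_simp.
  by rewrite -leNgt; lra.
rewrite big_cons => tw.
have cell u : 0 <= u <= w pr ->
    \int[mu]_(x in `]t0, t0 + u]) step_aux alpha (pr :: s) t0 x = k pr * u.
  move=> /andP[u0 uw]; rewrite (@eq_Rintegral _ _ _ _ _ (fun=> k pr)); last first.
    move=> x; rewrite inE /= in_itv /= => /andP[_ xu].
    by rewrite (le_trans xu) // lerD2l.
  rewrite Rintegral_cst //= lebesgue_measure_itv /= lte_fin.
  case: ltP => h; last by have -> : u = 0 by lra.
  by rewrite /= addrC addKr.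
have [tw'|wt] := leP t (w pr); first by apply: cell; rewrite t_ge0.
have int : mu.-integrable `]t0, t0 + t] (EFin \o step_aux alpha (pr :: s) t0).
  by apply: (@integrable_step_aux _ _ _ _ t0 (t0 + t)); exact: subset_itv_oc_cc.
have w0 := pair_weight_ge0 pr.
have := @Rintegral_itvB _ _ (BRight t0) (BRight (t0 + t)) (t0 + w pr) int.
rewrite !bnd_simp lerDl lerD2l w0 (ltW wt) => /(_ isT isT)/eqP.
rewrite subr_eq (cell (w pr)); last by rewrite w0 lexx.
move=> /eqP ->; rewrite addrC; congr (_ + _).
rewrite -(IH (t0 + w pr)); last by lra.
have -> : t0 + w pr + (t - w pr) = t0 + t by ring.
apply: eq_Rintegral => x; rewrite inE /= in_itv /= => /andP[xw _].
by rewrite leNgt xw.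
Qed.

Lemma lorenz_curveE W t : 0 <= t <= dC alpha W ->
  lorenz_curve alpha W t = lorenz_poly (biso_sorted alpha W) t.
Proof.
move=> t0; rewrite -(@Rintegral_step_aux _ 0); last first.
  by rewrite /biso_sorted (perm_big W) // perm_sort.
rewrite add0r /lorenz_curve.
have E : {in `]0, t], biso_curve alpha W =1 step_aux alpha (biso_sorted alpha W) 0}.
  move=> x; rewrite in_itv /= => /andP[x0 _].
  by rewrite /biso_curve leNgt x0.
have int : mu.-integrable `]0, t] (EFin \o step_aux alpha (biso_sorted alpha W) 0).
  by apply: (@integrable_step_aux _ _ _ _ 0 t); exact: subset_itv_oc_cc.
(* The point [0], where the curve is [0] by convention, has measure zero. *)
rewrite -Rintegral_itv_obnd_cbnd; first by apply: eq_Rintegral => x; rewrite inE; exact: E.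
apply: eq_integrable int => // x; rewrite inE => xt /=.
by rewrite E.
Qed.

(** * Legendre duality between Lorenz curves and hinge sums *)

Lemma lorenz_poly0 s : lorenz_poly s 0 = 0.
Proof. by case: s => //= pr s; rewrite pair_weight_ge0 mulr0. Qed.

(** The upper bound of the duality, valid for any order of the pairs: a piece of a cell contributes
    at most the positive part over the whole cell. *)
Lemma lorenz_poly_hinge_le s c t : 0 <= t <= \sum_(pr <- s) w pr ->
  c * t - lorenz_poly s t <= wsum w k s (hinge c).
Proof.
rewrite /wsum; elim: s t => [|pr s IH] t /=; rewrite ?big_nil ?big_cons => /andP[t0 tw].
  by (have -> : t = 0 by lra); rewrite mulr0 subr0.
have S0 : 0 <= wsum w k s (hinge c).
  by apply: sumr_ge0 => i _; rewrite mulr_ge0 ?hinge_ge0 ?pair_weight_ge0.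
have hc : c - k pr <= hinge c (k pr) by rewrite /hinge le_max lexx.
have h2 : w pr * (c - k pr) <= w pr * hinge c (k pr).
  by rewrite ler_wpM2l // pair_weight_ge0.
case: (leP t (w pr)) => [tle|tlt].
  have h3 : t * (c - k pr) <= t * hinge c (k pr) by rewrite ler_wpM2l.
  have h4 : t * hinge c (k pr) <= w pr * hinge c (k pr) by rewrite ler_wpM2r ?hinge_ge0.
  by move: S0; rewrite /wsum; lra.
have h1 : 0 <= t - w pr <= \sum_(j <- s) w j by lra.
by have := IH _ h1; lra.
Qed.

(** The maximum is reached at the total weight of the pairs with key at most [c]; sorting makes
    these an initial segment. *)
Lemma lorenz_poly_hinge_attained s c : sorted (fun u v => k u <= k v) s ->
  exists2 t, 0 <= t <= \sum_(pr <- s) w pr &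
    wsum w k s (hinge c) = c * t - lorenz_poly s t.
Proof.
rewrite /wsum; elim: s => [|pr s IH] /= srt.
  by exists 0; rewrite ?big_nil ?lexx // mulr0 subr0.
have w0 := pair_weight_ge0 pr.
have kle_trans : transitive (fun u v : R * R => k u <= k v).
  by move=> y x z; exact: le_trans.
have [kc|ck] := leP (k pr) c.
  have [t /andP[t0 tw] E] := IH (path_sorted srt).
  exists (w pr + t); rewrite !big_cons; first by lra.
  rewrite E /hinge max_l ?subr_ge0 //.
  have -> : w pr + t - w pr = t by ring.
  (* If [t = 0], the point ends the first cell and the other branch of [lorenz_poly] applies; the
     values agree. *)
  case: leP => h; last by ring.
  have -> : t = 0 by lra.
  by rewrite lorenz_poly0; ring.
exists 0.
  apply/andP; split; first exact: lexx.
  by apply: sumr_ge0 => i _; exact: pair_weight_ge0.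
rewrite big_cons w0 !mulr0 subr0.
rewrite {1}/hinge max_r ?subr_le0 ?(ltW ck) // mulr0 add0r.
have /allP pmin := order_path_min kle_trans srt.
rewrite big_seq big1 // => i /pmin ki.
by rewrite /hinge max_r ?mulr0 // subr_le0 (le_trans (ltW ck)).
Qed.

(** At the maximizer [t] for [W2], the smaller Lorenz curve of [W1] gives a larger [c * t - F t],
    which the hinge sum of [W1] bounds. *)
Lemma lorenz_hinge_le W1 W2 : dC alpha W1 = dC alpha W2 ->
  (forall t, 0 <= t <= dC alpha W1 -> lorenz_curve alpha W1 t <= lorenz_curve alpha W2 t) ->
  forall c, wsum w k W2 (hinge c) <= wsum w k W1 (hinge c).
Proof.
move=> dE F c.
have sortE W : perm_eq (biso_sorted alpha W) W by rewrite perm_sort.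
have wsE W : wsum w k W (hinge c) = wsum w k (biso_sorted alpha W) (hinge c).
  by rewrite /wsum (perm_big _ (sortE W)).
have dCE W : dC alpha W = \sum_(pr <- biso_sorted alpha W) w pr.
  by rewrite (perm_big _ (sortE W)).
have [|t] := @lorenz_poly_hinge_attained (biso_sorted alpha W2) c.
  by apply: sort_sorted => u v; exact: le_total.
rewrite -dCE => t2 E2.
have t1 : 0 <= t <= dC alpha W1 by rewrite dE.
rewrite (wsE W1) (wsE W2) E2 -lorenz_curveE //.
apply: le_trans (lorenz_poly_hinge_le c _); last by rewrite -dCE; exact: t1.
by rewrite -lorenz_curveE // lerD2l lerN2 F.
Qed.

End lorenz.

(** * Sibson mutual information of BISO channels *)

Section channel.
Context {R : realType}.
Implicit Types (alpha q c e x y : R) (pr : R * R) (W : biso_channel R).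

(* For the pair [(0, 0)] the junk value [0 / 0 = 0] is harmless: its weight is [0]. *)
Definition pair_tilt alpha pr : R :=
  `|1 - 2 * (pr.1 `^ alpha / (pr.1 `^ alpha + pr.2 `^ alpha))|.

Lemma pair_tilt_bounds alpha pr : 0 <= pair_tilt alpha pr <= 1.
Proof.
rewrite normr_ge0 /= ler_norml /=.
have a0 := powR_ge0 pr.1 alpha; have b0 := powR_ge0 pr.2 alpha.
set a := _ `^ _ in a0 *; set b := _ `^ _ in b0 *.
suff : 0 <= a / (a + b) <= 1 by lra.
rewrite divr_ge0 ?addr_ge0 //=.
have [->|ab0] := eqVneq (a + b) 0; first by rewrite invr0 mulr0.
by rewrite ler_pdivrMr ?mul1r ?lerDl // lt0r ab0 addr_ge0.
Qed.

Lemma pair_keyE alpha pr : pair_key alpha pr = hfun alpha^-1 (pair_tilt alpha pr).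
Proof.
have := pair_tilt_bounds alpha pr; rewrite /pair_tilt /pair_key.
set v := _ / _; rewrite ler_norml normr_ge0 /= => v1.
rewrite hfun_norm -hfunN hfunE; last by lra.
by congr (kfun _ _); field.
Qed.

(** With [v = a / (a + b)], the two bases divided by [a + b] are [(1 + y) / 2] and [(1 - y) / 2] for
    [y = (1 - 2 * q) * (1 - 2 * v)]; evenness of [h] admits absolute values. *)
Lemma pair_sibson_term alpha pr q : 0 < alpha -> 0 <= q <= 1 ->
  (q * pr.1 `^ alpha + (1 - q) * pr.2 `^ alpha) `^ alpha^-1
   + (q * pr.2 `^ alpha + (1 - q) * pr.1 `^ alpha) `^ alpha^-1 =
  pair_weight alpha pr * hfun alpha^-1 (`|1 - 2 * q| * pair_tilt alpha pr).
Proof.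
move=> a0 q01; have /andP[_] := pair_tilt_bounds alpha pr.
rewrite /pair_tilt -normrM hfun_norm /pair_weight.
have := powR_ge0 pr.1 alpha; have := powR_ge0 pr.2 alpha.
move: (pr.1 `^ alpha) (pr.2 `^ alpha) => a b b0 {}a0' v1.
have [ab0|ab0] := eqVneq (a + b) 0.
  have -> : a = 0 by lra.
  have -> : b = 0 by lra.
  by rewrite !mulr0 !addr0 powR0 ?mul0r ?addr0 // invr_eq0 gt_eqF.
have s0 : 0 < a + b by rewrite lt0r ab0 addr_ge0.
set y := (1 - 2 * q) * _.
have y1 : -1 <= y <= 1.
  have c1 : `|1 - 2 * q| <= 1 by rewrite ler_norml; lra.
  by rewrite -ler_norml /y normrM mulr_ile1.
rewrite /hfun !pospowE; [|lra|lra].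
rewrite mulrDr -!powRM ?(ltW s0) //; [|lra|lra].
by congr (_ `^ _ + _ `^ _); rewrite /y; field.
Qed.

(** * The sum inside the logarithm, and the capacity *)

Definition sibson_sum alpha W c : R :=
  \sum_(pr <- W) pair_weight alpha pr * hfun alpha^-1 (c * pair_tilt alpha pr).

Lemma sibsonMIE alpha W q : 0 < alpha -> alpha != 1 -> 0 <= q <= 1 ->
  sibsonMI alpha W q = - (alpha^-1 - 1)^-1 * ln (sibson_sum alpha W `|1 - 2 * q|).
Proof.
move=> a0 a1 q01; rewrite /sibsonMI; congr (_ * ln _).
  by field; rewrite mulN1r !subr_eq0 (eq_sym 1) a1 gt_eqF.
by apply: eq_bigr => pr _; exact: pair_sibson_term.
Qed.

(** [c = 1] is the deterministic input [q = 1], for which the summands are the transition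
    probabilities themselves. *)
Lemma sibson_sum1 alpha W : 0 < alpha -> is_biso W -> sibson_sum alpha W 1 = 1.
Proof.
move=> a0 [W0 S1]; rewrite -[RHS]S1; apply: eq_big_seq => pr /W0[p1 p2].
have := @pair_sibson_term alpha pr 1 a0; rewrite ler01 lexx => /(_ isT).
have -> : `|1 - 2 * 1| = 1 :> R by rewrite mulr1 distrC ger0_norm; lra.
move=> <-; rewrite subrr !mul1r !mul0r !addr0 -!powRrM mulfV ?gt_eqF //.
by rewrite !powRr1.
Qed.

Lemma wsum_key_id alpha W :
  wsum (pair_weight alpha) (pair_key alpha) W id = sibson_sum alpha W 1.
Proof. by apply: eq_bigr => pr _; rewrite mul1r pair_keyE. Qed.

Lemma wsum_key_one alpha W :
  wsum (pair_weight alpha) (pair_key alpha) W (fun=> 1) = dC alpha W.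
Proof. by apply: eq_bigr => pr _; rewrite mulr1. Qed.

(** Since [h] is positive, a zero sum would force all weights to vanish, against [sibson_sum1]. *)
Lemma sibson_sum_gt0 alpha W c : 0 < alpha -> is_biso W -> 0 < sibson_sum alpha W c.
Proof.
move=> a0 bW.
have t0 d pr : 0 <= pair_weight alpha pr * hfun alpha^-1 (d * pair_tilt alpha pr).
  by rewrite mulr_ge0 ?powR_ge0 // ltW // hfun_gt0.
rewrite lt0r sumr_ge0 // andbT; apply/negP => S0.
have := oner_neq0 R; rewrite -(sibson_sum1 a0 bW) => /negP; apply.
move: S0; rewrite !psumr_eq0 //; apply: sub_all => pr /=.
by rewrite !mulf_eq0 !(gt_eqF (hfun_gt0 _ _)) !orbF.
Qed.

Lemma sibson_sum0 alpha W : sibson_sum alpha W 0 = hfun alpha^-1 0 * dC alpha W.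
Proof.
by rewrite /sibson_sum mulrC big_distrl; apply: eq_bigr => pr _; rewrite mul0r.
Qed.

Lemma sibson_value_le (g A B : R) : g != 0 -> 0 < A -> 0 < B -> g * A <= g * B ->
  - g^-1 * ln B <= - g^-1 * ln A.
Proof.
move=> g0 A0 B0 gAB; have [g_lt0|g_gt0|gE] := ltgtP g 0; last by rewrite gE eqxx in g0.
  have AB : B <= A by rewrite -(ler_nM2l g_lt0).
  by rewrite ler_wpM2l ?oppr_ge0 ?invr_le0 ?(ltW g_lt0) // ler_ln ?posrE.
have AB : A <= B by rewrite -(ler_pM2l g_gt0).
by rewrite ler_wnM2l ?oppr_le0 ?invr_ge0 ?(ltW g_gt0) // ler_ln ?posrE.
Qed.

Lemma inv_sub1_neq0 alpha : alpha != 1 -> alpha^-1 - 1 != 0.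
Proof. by move=> a1; rewrite subr_eq0 invr_eq1. Qed.

Lemma norm_one_sub2_bounds q : 0 <= q <= 1 -> 0 <= `|1 - 2 * q| <= 1.
Proof. by move=> q01; rewrite normr_ge0 ler_norml; lra. Qed.

(** The uniform input has [c = 0], which minimizes every [(b - 1) * h (c x)] by [hfun_le] and so
    maximizes the information. *)
Lemma alpha_capacityE alpha W : 0 < alpha -> alpha != 1 -> is_biso W ->
  alpha_capacity alpha W = - (alpha^-1 - 1)^-1 * ln (hfun alpha^-1 0 * dC alpha W).
Proof.
move=> a0 a1 bW; set M := RHS.
have b0 : 0 < alpha^-1 by rewrite invr_gt0.
have b1 : alpha^-1 != 1 by rewrite invr_eq1.
have half : sibsonMI alpha W 2^-1 = M.
  rewrite sibsonMIE //; last by lra.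
  by rewrite mulfV ?pnatr_eq0 // subrr normr0 sibson_sum0.
have M_in : [set sibsonMI alpha W q | q in `[0, 1]] M.
  by exists 2^-1 => //=; rewrite in_itv /=; lra.
have M_ub : ubound [set sibsonMI alpha W q | q in `[0, 1]] M.
  move=> v [q]; rewrite /= in_itv /= => q01 <-.
  rewrite sibsonMIE // /M -sibson_sum0.
  apply: sibson_value_le; rewrite ?sibson_sum_gt0 ?inv_sub1_neq0 //.
  rewrite !mulr_sumr; apply: ler_sum => pr _.
  rewrite mul0r mulrCA [leRHS]mulrCA ler_wpM2l ?powR_ge0 //.
  have /andP[c0 c1] := norm_one_sub2_bounds q01.
  have /andP[x0 x1] := pair_tilt_bounds alpha pr.
  by apply: hfun_le => //; rewrite ?mulr_ge0 ?mulr_ile1.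
apply/eqP; rewrite eq_le; apply/andP; split.
  by apply: ge_sup => //; exists M.
by apply: ub_le_sup => //; exists M.
Qed.

Lemma dC_eq alpha W1 W2 : 0 < alpha -> alpha != 1 -> is_biso W1 -> is_biso W2 ->
  alpha_capacity alpha W1 = alpha_capacity alpha W2 -> dC alpha W1 = dC alpha W2.
Proof.
move=> a0 a1 bW1 bW2; rewrite !alpha_capacityE //.
have h0 := @hfun_gt0 R alpha^-1 0.
have n0 : - (alpha^-1 - 1)^-1 != 0 by rewrite oppr_eq0 invr_eq0 inv_sub1_neq0.
move=> /(mulfI n0) /ln_inj; rewrite !posrE -!sibson_sum0 !sibson_sum_gt0 //.
by move=> /(_ isT isT); rewrite !sibson_sum0 => /mulfI; apply; rewrite gt_eqF.
Qed.

(** Recovers the tilt from the key, so that [h (c x)] becomes a function of the key as [wsum]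
    requires; the value off the range of [h] is [0]. *)
Definition hfun_inv b k : R := xget 0 [set x | 0 <= x <= 1 /\ hfun b x = k].

Lemma hfunK b x : 0 < b -> b != 1 -> 0 <= x <= 1 -> hfun_inv b (hfun b x) = x.
Proof.
move=> b0 b1 x01; rewrite /hfun_inv; case: xgetP => [y _ /= [y01 E]|/(_ x)]; last first.
  by case.
have [xy|yx|//] := ltgtP y x.
  by have := @hfun_lt _ b y x; rewrite E ltxx => H; suff : false by []; apply: H => //; lra.
by have := @hfun_lt _ b x y; rewrite E ltxx => H; suff : false by []; apply: H => //; lra.
Qed.

Lemma hfun_inv_convex b e c (z : seq R) : 0 < b -> b != 1 ->
  0 <= e * ((2 - b) * (3 - b)) -> 0 <= c <= 1 ->
  (forall k, k \in z -> exists2 x, 0 <= x <= 1 & k = hfun b x) ->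
  convex_on z (fun k => - (e * (b - 1) * hfun b (c * hfun_inv b k))).
Proof.
move=> b0 b1 eb c01 zP x y t /zP[x0 x01 ->] /zP[y0 y01 ->] /zP[t0 t01 ->] xy yt.
rewrite !hfunK //.
have g0 : b - 1 != 0 by rewrite subr_eq0.
have y_int : 0 < y0 < 1.
  (* By monotonicity of [h], a tilt of [0] or [1] has an extreme key, which cannot lie strictly
     between two others. *)
  have [yz|yo] : 0 < y0 < 1 \/ (y0 = 0 \/ y0 = 1) by lra.
    exact: yz.
  have mono u v : 0 <= u <= 1 -> 0 <= v <= 1 -> u <= v ->
      (b - 1) * hfun b u <= (b - 1) * hfun b v.
    by move=> /andP[? ?] /andP[? ?] ?; exact: hfun_le.
  have [g_lt0|g_gt0|gE] := ltgtP (b - 1) 0; last by rewrite gE eqxx in g0.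
    have anti u v : 0 <= u <= 1 -> 0 <= v <= 1 -> u <= v -> hfun b v <= hfun b u.
      by move=> u01 v01 /(mono _ _ u01 v01); rewrite ler_nM2l.
    case: yo => yE; rewrite {}yE in xy yt y01.
      by have := anti 0 t0; lra.
    by have := anti x0 1; lra.
  have homo u v : 0 <= u <= 1 -> 0 <= v <= 1 -> u <= v -> hfun b u <= hfun b v.
    by move=> u01 v01 /(mono _ _ u01 v01); rewrite ler_pM2l.
  case: yo => yE; rewrite {}yE in xy yt y01.
    by have := homo 0 x0; lra.
  by have := homo t0 1; lra.
exists (- (e * (b - 1) * slope (b - 1) c y0)).
have H u : 0 <= u <= 1 -> _ := @hfun_support _ b e c u y0 b0 b1 eb c01 y_int.
by have := H _ x01; have := H _ t01; split; lra.
Qed.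

Lemma sibson_sum_le alpha e c W1 W2 : 0 < alpha -> alpha != 1 ->
  is_biso W1 -> is_biso W2 -> dC alpha W1 = dC alpha W2 ->
  (forall t : R, 0 <= t <= dC alpha W1 ->
     lorenz_curve alpha W1 t <= lorenz_curve alpha W2 t) ->
  0 <= e * ((2 - alpha^-1) * (3 - alpha^-1)) -> 0 <= c <= 1 ->
  e * (alpha^-1 - 1) * sibson_sum alpha W1 c <= e * (alpha^-1 - 1) * sibson_sum alpha W2 c.
Proof.
move=> a0 a1 bW1 bW2 dE F eb c01.
have b0 : 0 < alpha^-1 by rewrite invr_gt0.
have b1 : alpha^-1 != 1 by rewrite invr_eq1.
set b := alpha^-1 in b0 b1 eb *.
(* The sign makes [u] convex in the key; it is also what reverses the order of the two channels in
   the conclusion. *)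
pose u k := - (e * (b - 1) * hfun b (c * hfun_inv b k)).
have sumE W : wsum (pair_weight alpha) (pair_key alpha) W u =
    - (e * (b - 1) * sibson_sum alpha W c).
  rewrite mulr_sumr -sumrN; apply: eq_bigr => pr _.
  by rewrite /u pair_keyE hfunK ?pair_tilt_bounds // mulrN mulrCA.
have : wsum (pair_weight alpha) (pair_key alpha) W2 u <=
       wsum (pair_weight alpha) (pair_key alpha) W1 u.
  apply: wsum_convex_le.
  - by rewrite !wsum_key_one.
  - by rewrite !wsum_key_id !sibson_sum1.
  - exact: lorenz_hinge_le.
  - apply: hfun_inv_convex => // _ /mapP[pr _ ->].
    by exists (pair_tilt alpha pr); [exact: pair_tilt_bounds|rewrite pair_keyE].
by rewrite !sumE lerN2.
Qed.

End channel.

Theorem theorem1 (R : realType) (alpha : R) (W1 W2 : biso_channel R) :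
  0 < alpha -> alpha != 1 ->
  is_biso W1 -> is_biso W2 ->
  alpha_capacity alpha W1 = alpha_capacity alpha W2 ->
  (forall t : R, 0 <= t <= dC alpha W1 ->
     lorenz_curve alpha W1 t <= lorenz_curve alpha W2 t) ->
  ((1 < alpha \/ (2^-1 <= alpha < 1) \/ alpha <= 3^-1) ->
     more_capable alpha W1 W2) /\
  (3^-1 <= alpha <= 2^-1 -> more_capable alpha W2 W1).
Proof.
move=> a0 a1 bW1 bW2 capE F.
have dE := dC_eq a0 a1 bW1 bW2 capE.
have b0 : 0 < alpha^-1 by rewrite invr_gt0.
have le_inv x : 0 < x -> alpha <= x^-1 -> x <= alpha^-1.
  by move=> x0 ax; rewrite -[x]invrK lef_pV2 // posrE invr_gt0.
have ge_inv x : 0 < x -> x^-1 <= alpha -> alpha^-1 <= x.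
  by move=> x0 ax; rewrite -[x]invrK lef_pV2 // posrE invr_gt0.
split=> [range q q01|/andP[a3 a2] q q01].
- have c01 := norm_one_sub2_bounds q01.
  rewrite !sibsonMIE //; apply: sibson_value_le; rewrite ?inv_sub1_neq0 ?sibson_sum_gt0 //.
  (* With [b = alpha^-1], the product [(2 - b) * (3 - b)] is nonnegative for [b <= 2] and for
     [3 <= b]. *)
  have := @sibson_sum_le _ alpha 1 _ _ _ a0 a1 bW1 bW2 dE F _ c01.
  rewrite !mul1r; apply.
  have [b2|b3] : alpha^-1 <= 2 \/ 3 <= alpha^-1.
    case: range => [a_gt1|[/andP[a2 _]|a3]]; [left|left|right].
    + by apply: ge_inv => //; lra.
    + exact: ge_inv.
    + exact: le_inv.
    + by rewrite mulr_ge0 //; lra.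
  by rewrite -mulrNN mulr_ge0 //; lra.
- have c01 := norm_one_sub2_bounds q01.
  rewrite !sibsonMIE //; apply: sibson_value_le; rewrite ?inv_sub1_neq0 ?sibson_sum_gt0 //.
  (* For [b] between [2] and [3] the product is nonpositive, so [e = -1] reverses the comparison. *)
  have := @sibson_sum_le _ alpha (-1) _ _ _ a0 a1 bW1 bW2 dE F _ c01.
  rewrite !mulN1r !mulNr lerN2; apply.
  have b2 : 2 <= alpha^-1 by apply: le_inv.
  have b3 : alpha^-1 <= 3 by apply: ge_inv.
  by rewrite -mulNr mulr_ge0 //; lra.
Qed.
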